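(* Let $n,s$ be integers with $s\ge 10$ and $n\le 3s$. If $\mathcal F\subset\binom{[n]}{3}$ has property $U(s,2s+1)$, i.e. $|F_1\cup\ldots\cup F_s|\le 2s+1$ for all $F_1,\ldots,F_s\in\mathcal F$, then $|\mathcal F|\le\binom{2s+1}{3}$.
   Context: $\binom{[n]}{3}$ is the set of $3$-subsets of $[n]=\{1,\ldots,n\}$; the sets $F_i$ need not be distinct. The bound $\binom{2s+1}{3}$ is the size of the family $\mathcal A(2s+1,3,n,3)=\{A\in\binom{[n]}{3}:|A\cap[2s+1]|\ge 3\}$. *)

(* Defs.v *)
From mathcomp Require Import all_boot.
Set Implicit Arguments.
Unset Strict Implicit.
Unset Printing Implicit Defensive.

(* The ground set [n] = {1, ..., n} is represented by 'I_n = {0, ..., n-1}. *)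

Definition ksubsets (n k : nat) : {set {set 'I_n}} :=
  [set A : {set 'I_n} | #|A| == k].

(* The s-tuple (F_1, ..., F_s) is a function G, not required to be injective. *)
Definition propertyU (n : nat) (F : {set {set 'I_n}}) (s q : nat) : Prop :=
  forall G : 'I_s -> {set 'I_n},
    (forall i, G i \in F) -> #|\bigcup_(i < s) G i| <= q.

(* Main.v *)
(** Shifting (replacing [j] by [i < j]) preserves [U(s, q)] and the size of the
    family, so the family may be assumed shifted.  Let [q = 2s+1].  If the
    family has a member reaching [q] or beyond, it contains [{0,1,q}].
    - If [{1,2,q}] is a member, it cannot be completed to a cover of [{0..q}] by
      the [s-1] triples [{0, 2+i, q-i}], so one of these is missing.
    - Otherwise every member reaching [q] contains [0].  Either [{2,3,4}] is
      missing, and all members meet [{0,1}], or [{0,1,q}] and [{2,3,4}] cannot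
      be completed to a cover of [{0..q}] by the [s-2] triples [{0, 4+i, q-i}],
      so one of these is missing.
    Shiftedness turns one missing triple into a bound on the whole family, and
    the resulting cubics in [i] stay below ['C(q, 3)]. *)

Require Import Defs.
From mathcomp Require Import all_boot.
From mathcomp Require Import zify.
Set Implicit Arguments.
Unset Strict Implicit.
Unset Printing Implicit Defensive.

Definition exchange (T : finType) (i j : T) (A : {set T}) : {set T} :=
  i |: (A :\ j).

Lemma card_exchange (T : finType) (i j : T) (A : {set T}) :
  j \in A -> i \notin A -> #|exchange i j A| = #|A|.
Proof.
by move=> jA iA; rewrite cardsU1 (cardsD1 j A) jA !inE negb_and iA orbT.
Qed.

Lemma exchangeK (T : finType) (i j : T) (A : {set T}) :
  j \in A -> i \notin A -> exchange j i (exchange i j A) = A.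
Proof.
move=> jA iA; rewrite /exchange setU1K ?setD1K //.
by rewrite !inE negb_and iA orbT.
Qed.

Section Shift.

Variables (T : finType) (i j : T).
Implicit Types (A B : {set T}) (F : {set {set T}}).

Definition shift_elt F A : {set T} :=
  if [&& j \in A, i \notin A & exchange i j A \notin F]
  then exchange i j A else A.

Definition shift F : {set {set T}} := shift_elt F @: F.

Lemma card_shift_elt F A : #|shift_elt F A| = #|A|.
Proof.
by rewrite /shift_elt; case: ifP => // /and3P[jA iA _]; rewrite card_exchange.
Qed.

Lemma shift_elt_inj F : {in F &, injective (shift_elt F)}.
Proof.
move=> A B AF BF; rewrite /shift_elt.
case: ifP => [/and3P[jA iA eA]|_]; case: ifP => [/and3P[jB iB eB]|_] //.
- by move=> eAB; rewrite -(exchangeK jA iA) eAB exchangeK.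
- by move=> eAB; rewrite eAB BF in eA.
- by move=> eAB; rewrite -eAB AF in eB.
Qed.

Lemma card_shift F : #|shift F| = #|F|.
Proof. exact/card_in_imset/shift_elt_inj. Qed.

Lemma shift_exchange F A :
  A \in shift F -> j \in A -> i \notin A -> exchange i j A \in F.
Proof.
move=> /imsetP[B BF ->]; rewrite /shift_elt.
case: ifP => [_ _|kept jB iB]; first by rewrite !inE eqxx.
by move: kept; rewrite jB iB /= => /negbFE.
Qed.

Lemma shift_notin F A : A \in shift F -> A \notin F ->
  [/\ i \in A, j \notin A & exchange j i A \in F].
Proof.
move=> /imsetP[B BF ->]; rewrite /shift_elt.
case: ifP => [/and3P[jB iB eB] _|_]; last by rewrite BF.
split; [by rewrite !inE eqxx| | by rewrite exchangeK].
by rewrite !inE negb_or eqxx /= andbT; apply: contraNneq iB => <-.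
Qed.

(* Undoing the exchange on the members outside [F] may lose [i] from a union of
   members; exchanging the members of [F] that contain [j] recovers it. *)
Definition unshift_elt F A : {set T} :=
  if A \notin F then exchange j i A
  else if (j \in A) && (i \notin A) then exchange i j A else A.

Lemma unshift_elt_in F A : A \in shift F -> unshift_elt F A \in F.
Proof.
move=> AS; rewrite /unshift_elt; case: ifPn => [AF|/negPn AF].
  by case: (shift_notin AS AF).
by case: ifP => // /andP[]; apply: shift_exchange.
Qed.

Lemma mem_unshift_elt F A x :
  x != i -> x != j -> (x \in unshift_elt F A) = (x \in A).
Proof.
move=> /negPf xi /negPf xj; rewrite /unshift_elt.
by do 2?case: ifP => _; rewrite // !inE xi xj.
Qed.

Lemma unshift_elt_gain F A :
  A \in shift F -> j \in A -> i \in unshift_elt F A.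
Proof.
move=> AS jA; rewrite /unshift_elt jA; case: ifPn => [AF|_].
  by case: (shift_notin AS AF); rewrite jA.
by case: ifP => [_|/negbFE //]; rewrite !inE eqxx.
Qed.

End Shift.

Lemma propertyU_shift (n : nat) (F : {set {set 'I_n}}) (s q : nat)
    (i j : 'I_n) :
  propertyU F s q -> propertyU (shift i j F) s q.
Proof.
move=> FU G GS.
case: (pickP (fun l => G l \notin F)) => [l0 Gl0|GF]; last first.
  by apply: FU => l; apply/negbFE/GF.
have [il0 _ _] := shift_notin (GS l0) Gl0.
pose H l := unshift_elt i j F (G l).
apply: leq_trans (FU H (fun l => unshift_elt_in (GS l))).
have jH : j \in \bigcup_l H l.
  by apply/bigcupP; exists l0 => //; rewrite /H /unshift_elt Gl0 !inE eqxx.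
have keep x : x != i -> x != j -> x \in \bigcup_l G l -> x \in \bigcup_l H l.
  move=> xi xj /bigcupP[l _ xG].
  by apply/bigcupP; exists l; rewrite // mem_unshift_elt.
have [/bigcupP[l _ jG]|jU] := boolP (j \in \bigcup_l G l).
  apply/subset_leq_card/subsetP => x xU.
  have [->//|xj] := eqVneq x j; have [->|xi] := eqVneq x i; last exact: keep.
  by apply/bigcupP; exists l; rewrite // unshift_elt_gain.
have iU : i \in \bigcup_l G l by apply/bigcupP; exists l0.
rewrite -(card_exchange iU jU); apply/subset_leq_card/subsetP => x.
rewrite !inE => /orP[/eqP->//|/andP[xi xU]].
by apply: keep => //; apply: contraNneq jU => <-.
Qed.

Lemma shift_ksubsets (n k : nat) (F : {set {set 'I_n}}) (i j : 'I_n) :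
  F \subset ksubsets n k -> shift i j F \subset ksubsets n k.
Proof.
move=> /subsetP Fk; apply/subsetP => _ /imsetP[A AF ->].
by have := Fk A AF; rewrite !inE card_shift_elt.
Qed.

Definition weight (n : nat) (F : {set {set 'I_n}}) : nat :=
  \sum_(A in F) \sum_(x in A) x.

Lemma sum_exchange (n : nat) (i j : 'I_n) (A : {set 'I_n}) :
  i < j -> j \in A -> i \notin A ->
  \sum_(x in exchange i j A) x < \sum_(x in A) x.
Proof.
move=> ij jA iA; rewrite big_setU1 /=; last by rewrite !inE negb_and iA orbT.
by rewrite [ltnRHS](big_setD1 j) //= ltn_add2r.
Qed.

Lemma weight_shift (n : nat) (F : {set {set 'I_n}}) (i j : 'I_n)
    (A : {set 'I_n}) :
  i < j -> A \in F -> j \in A -> i \notin A -> exchange i j A \notin F ->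
  weight (shift i j F) < weight F.
Proof.
move=> ij AF jA iA eA; rewrite /weight big_imset /=; last exact: shift_elt_inj.
rewrite (big_setD1 A) //= [ltnRHS](big_setD1 A) //= -addSn.
apply: leq_add; first by rewrite /shift_elt jA iA eA /= sum_exchange.
apply: leq_sum => B _; rewrite /shift_elt.
by case: ifP => // /and3P[jB iB _]; apply/ltnW/sum_exchange.
Qed.

Definition shifted (n : nat) (F : {set {set 'I_n}}) : Prop :=
  forall (A : {set 'I_n}) (i j : 'I_n),
    A \in F -> i < j -> j \in A -> i \notin A -> exchange i j A \in F.

Lemma shifted_reduction (n k s q : nat) (F : {set {set 'I_n}}) :
  F \subset ksubsets n k -> propertyU F s q ->
  exists F' : {set {set 'I_n}},
    [/\ F' \subset ksubsets n k, propertyU F' s q, shifted F' & #|F'| = #|F|].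
Proof.
have [w] := ubnP (weight F); elim: w F => // w IHw F wF Fk FU.
pose compressible (u : {set 'I_n} * ('I_n * 'I_n)) :=
  let: (A, (i, j)) := u in
  [&& A \in F, i < j, j \in A, i \notin A & exchange i j A \notin F].
case: (pickP compressible) => [[A [i j]] /and5P[AF ij jA iA eA]|noA].
  have wS := leq_trans (weight_shift ij AF jA iA eA) wF.
  have [F' [F'k F'U sF' cF']] :=
    IHw _ wS (shift_ksubsets i j Fk) (propertyU_shift FU).
  by exists F'; rewrite cF' card_shift.
exists F; split=> // A i j AF ij jA iA.
by have := noA (A, (i, j)); rewrite /= AF ij jA iA => /negbFE.
Qed.

(* Entries that are at least [n] are dropped. *)
Definition triple (n a b c : nat) : {set 'I_n} :=
  [set x : 'I_n | [|| x == a :> nat, x == b :> nat | x == c :> nat]].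

Lemma triple_rot (n a b c : nat) : triple n a b c = triple n b c a.
Proof. by apply/setP => x; rewrite !inE orbC -orbA. Qed.

Lemma triple_ord (n : nat) (a b c : 'I_n) : triple n a b c = [set a; b; c].
Proof. by apply/setP => x; rewrite !inE -orbA. Qed.

Lemma enum_ord_set_sorted (n : nat) (A : {set 'I_n}) :
  sorted (fun x y : 'I_n => x < y) (enum A).
Proof.
rewrite /enum_mem -enumT.
apply: sorted_filter => [x y z|]; first exact: ltn_trans.
have := iota_ltn_sorted 0 n.
by rewrite -val_enum_ord sorted_map.
Qed.

Lemma ksubsets3_triple (n : nat) (A : {set 'I_n}) :
  A \in ksubsets n 3 ->
  exists a b c : 'I_n, [/\ a < b, b < c & A = triple n a b c].
Proof.
rewrite inE cardE => A3; have := enum_ord_set_sorted A; have := mem_enum A.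
case: (enum A) A3 => [|a [|b [|c []]]] //= _ memA /and3P[ab bc _].
by exists a, b, c; split=> //; apply/setP => x; rewrite -memA !inE.
Qed.

Lemma triple_ksubsets_lt (n a b c : nat) :
  triple n a b c \in ksubsets n 3 -> c < n.
Proof.
move=> /ksubsets3_triple[x [y [z [xy yz /setP eq_triple]]]].
have := eq_triple x; have := eq_triple y; have := eq_triple z.
rewrite !inE !eqxx !orbT.
by have := ltn_ord x; have := ltn_ord y; have := ltn_ord z; lia.
Qed.

Definition ord_itv (n p m : nat) : {set 'I_n} := [set x : 'I_n | p <= x < m].

Lemma card_ord_itv (n p m : nat) : #|ord_itv n p m| = minn m n - p.
Proof.
rewrite -sum1dep_card; elim: n => [|n IHn]; first by rewrite big_ord0; lia.
rewrite big_mkcond big_ord_recr /= -big_mkcond /= IHn.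
by case: ifP; lia.
Qed.

Lemma leq_card_ord_itv (n p m : nat) : #|ord_itv n p m| <= m - p.
Proof. by rewrite card_ord_itv leq_sub2r // geq_minl. Qed.

Definition initial_draws (n m k : nat) : {set {set 'I_n}} :=
  [set A : {set 'I_n} | A \subset ord_itv n 0 m & #|A| == k].

Lemma leq_card_initial_draws (n m k : nat) : #|initial_draws n m k| <= 'C(m, k).
Proof. by rewrite cards_draws leq_bin2l // -[leqRHS]subn0 leq_card_ord_itv. Qed.

Lemma leq_card_imset2 (S T R : finType) (f : S -> T -> R)
    (A : {set S}) (B : {set T}) :
  #|[set f x y | x in A, y in B]| <= #|A| * #|B|.
Proof. by rewrite curry_imset2X -cardsX leq_imset_card. Qed.

Lemma mul2_bin2 (m : nat) : 2 * 'C(m.+1, 2) = m.+1 * m.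
Proof. by rewrite mulnC (bin_ffact _ 2) ffactSS ffactn1. Qed.

Lemma mul6_bin3 (m : nat) : 6 * 'C(m.+2, 3) = m.+2 * m.+1 * m.
Proof. by rewrite mulnC (bin_ffact _ 3) !ffactSS ffactn1 mulnA. Qed.

Lemma mul6_bin2M (m k : nat) : 6 * ('C(m.+1, 2) * k) = 3 * (m.+1 * m * k).
Proof. by rewrite -mul2_bin2 -(mulnA 2) (mulnA 3). Qed.

Lemma pairs_count_leq_bin3 (n s i : nat) :
  n <= 3 * s -> 0 < i < s ->
  'C(2 * s + 1 - i, 3) + 'C(2 + i, 2) * (n - (2 * s + 1 - i))
    <= 'C(2 * s + 1, 3).
Proof.
move=> ns /andP[i0 lt_is].
(* Slack variables for the range of [i] make truncated subtraction disappear. *)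
have [x def_i] : exists x, i = x + 1 by exists (i - 1); lia.
have [y def_s] : exists y, s = x + y + 2 by exists (s - i - 1); lia.
have far : 'C(2 + i, 2) * (n - (2 * s + 1 - i))
    <= 'C(2 + i, 2) * (2 * x + y + 2).
  by rewrite leq_mul2l; lia.
apply: leq_trans (leq_add (leqnn _) far) _.
have -> : 2 * s + 1 = (2 * x + 2 * y + 3).+2 by lia.
have -> : (2 * x + 2 * y + 3).+2 - i = (x + 2 * y + 2).+2 by lia.
have -> : 2 + i = (x + 2).+1 by lia.
by rewrite -(@leq_pmul2l 6) // mulnDr mul6_bin2M !mul6_bin3; nia.
Qed.

Lemma star_count_leq_bin3 (n s i : nat) :
  4 <= s -> n <= 3 * s -> 0 < i < s - 1 ->
  'C(2 * s + 1 - i, 3) + 'C(4 + i, 2) * i + (3 + i) * (n - (2 * s + 1))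
    <= 'C(2 * s + 1, 3).
Proof.
move=> s4 ns /andP[i0 lt_is].
have [x def_i] : exists x, i = x + 1 by exists (i - 1); lia.
have [y def_s] : exists y, s = x + y + 3 by exists (s - i - 2); lia.
have far : (3 + i) * (n - (2 * s + 1)) <= (3 + i) * (x + y + 2).
  by rewrite leq_mul2l; lia.
apply: leq_trans (leq_add (leqnn _) far) _.
have -> : 2 * s + 1 = (2 * x + 2 * y + 5).+2 by lia.
have -> : (2 * x + 2 * y + 5).+2 - i = (x + 2 * y + 4).+2 by lia.
have -> : 4 + i = (x + 4).+1 by lia.
have xy : 1 <= x + y by lia.
rewrite def_i -(@leq_pmul2l 6) // 2!mulnDr mul6_bin2M !mul6_bin3.
(* The difference of the two sides is now a cubic in [x] and [y] whose only
   negative coefficient is the constant one, [-18]. *)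
by nia.
Qed.

Lemma transversal_count_leq_bin3 (n s : nat) :
  7 <= s -> n <= 3 * s -> 2 * 'C(n, 2) <= 'C(2 * s + 1, 3).
Proof.
move=> s7 ns; apply: (@leq_trans (2 * 'C(3 * s, 2))).
  by rewrite leq_mul2l leq_bin2l.
have [y ->] : exists y, s = y + 7 by exists (s - 7); lia.
have -> : 3 * (y + 7) = (3 * y + 20).+1 by lia.
have -> : 2 * (y + 7) + 1 = (2 * y + 13).+2 by lia.
by rewrite mul2_bin2 -(@leq_pmul2l 6) // mul6_bin3; nia.
Qed.

Lemma shifted_lower_triple (n : nat) (F : {set {set 'I_n}}) (a b c a' : nat) :
  shifted F -> triple n a b c \in F -> a' <= a -> a < n ->
  a' != b -> a' != c -> a != b -> a != c -> triple n a' b c \in F.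
Proof.
move=> sF abcF le_aa an ab' ac' ab ac; have [->//|ne_aa] := eqVneq a' a.
have lt_aa : a' < a by rewrite ltn_neqAle ne_aa.
have := sF _ (Ordinal (ltn_trans lt_aa an)) (Ordinal an) abcF lt_aa.
rewrite !inE /= eqxx (negPf ne_aa) (negPf ab') (negPf ac') => /(_ isT isT).
by congr (_ \in F); apply/setP => x; rewrite !inE -!val_eqE /=; lia.
Qed.

Section ShiftedTriples.

Variables (n : nat) (F : {set {set 'I_n}}).
Hypotheses (F3 : F \subset ksubsets n 3) (sF : shifted F).

Lemma shifted_triple (a b c a' b' c' : nat) :
  triple n a b c \in F -> a < b -> b < c ->
  a' <= a -> b' <= b -> c' <= c -> a' < b' -> b' < c' ->
  triple n a' b' c' \in F.
Proof.
move=> abcF ab bc le_a le_b le_c ab' bc'.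
have cn := triple_ksubsets_lt (subsetP F3 _ abcF).
have bca'F : triple n b c a' \in F.
  by rewrite -triple_rot; apply: (shifted_lower_triple sF abcF); lia.
have ca'b'F : triple n c a' b' \in F.
  by rewrite -triple_rot; apply: (shifted_lower_triple sF bca'F); lia.
by rewrite -triple_rot; apply: (shifted_lower_triple sF ca'b'F); lia.
Qed.

Lemma shifted_missing_triple (a b c a' b' c' : nat) :
  triple n a b c \in F -> a < b -> b < c ->
  a' < b' -> b' < c' -> triple n a' b' c' \notin F ->
  [|| a < a', b < b' | c < c'].
Proof.
move=> abcF ab bc ab' bc'; apply: contraNT; rewrite !negb_or -!leqNgt.
by move=> /and3P[le_a le_b le_c]; apply: shifted_triple abcF _ _ _ _ _ _ _.
Qed.

Lemma leq_card_missing_consecutive_triple (r : nat) :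
  triple n r r.+1 r.+2 \notin F -> #|F| <= r * 'C(n, 2).
Proof.
move=> NF.
have sub : F \subset [set a |: P | a in ord_itv n 0 r, P in ksubsets n 2].
  apply/subsetP => A AF.
  have [a [b [c [ab bc defA]]]] := ksubsets3_triple (subsetP F3 A AF).
  rewrite {}defA in AF *.
  have lt_ar := shifted_missing_triple AF ab bc (ltnSn _) (ltnSn _) NF.
  rewrite triple_ord -setUA; apply: imset2_f; rewrite inE; first lia.
  by rewrite cards2 -val_eqE /= (ltn_eqF bc).
apply: leq_trans (subset_leq_card sub) _.
apply: leq_trans (leq_card_imset2 _ _ _) (leq_mul _ _).
  by rewrite -[leqRHS]subn0 leq_card_ord_itv.
by rewrite card_draws card_ord.
Qed.

Lemma leq_card_missing_zero_triple_star (r p q : nat) :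
  0 < r < p -> triple n 0 r p \notin F ->
  (forall a b c : 'I_n,
    triple n a b c \in F -> a < b -> b < c -> q <= c -> a = 0 :> nat) ->
  #|F| <= 'C(p, 3) + 'C(r, 2) * (q - p) + r.-1 * (n - q).
Proof.
move=> /andP[r0 rp] NF star.
pose middle := [set P :|: [set c]
                 | P in initial_draws n r 2, c in ord_itv n p q].
pose far := [set triple n 0 (b : 'I_n) (c : 'I_n)
              | b in ord_itv n 1 r, c in ord_itv n q n].
have sub : F \subset initial_draws n p 3 :|: middle :|: far.
  apply/subsetP => A AF; have A3 := subsetP F3 A AF; rewrite !in_setU -orbA.
  have [a [b [c [ab bc defA]]]] := ksubsets3_triple A3.
  rewrite {}defA in AF A3 *.
  have br_or_cp := shifted_missing_triple AF ab bc r0 rp NF.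
  have [cp|pc] := ltnP c p; apply/or3P.
    apply: Or31; move: A3; rewrite !inE => ->; rewrite andbT.
    by apply/subsetP => x; rewrite !inE; lia.
  have [cq|qc] := ltnP c q.
    apply: Or32; rewrite triple_ord; apply: imset2_f; rewrite inE ?pc //.
    rewrite cards2 -val_eqE /= (ltn_eqF ab) andbT.
    by apply/subsetP => x; rewrite !inE -!val_eqE /=; lia.
  apply: Or33; have a0 := star _ _ _ AF ab bc qc; rewrite a0.
  by apply: imset2_f; rewrite inE ?qc ?ltn_ord //; lia.
apply: leq_trans (subset_leq_card sub) _.
apply: leq_trans (leq_card_setU _ _) (leq_add _ _).
  apply: leq_trans (leq_card_setU _ _) (leq_add _ _).
    exact: leq_card_initial_draws.
  apply: leq_trans (leq_card_imset2 _ _ _) (leq_mul _ (leq_card_ord_itv _ _ _)).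
  exact: leq_card_initial_draws.
apply: leq_trans (leq_card_imset2 _ _ _) (leq_mul _ (leq_card_ord_itv _ _ _)).
by rewrite -subn1 leq_card_ord_itv.
Qed.

Lemma leq_card_missing_zero_triple (r p : nat) :
  0 < r < p -> triple n 0 r p \notin F ->
  #|F| <= 'C(p, 3) + 'C(r, 2) * (n - p).
Proof.
move=> rp NF; have := @leq_card_missing_zero_triple_star r p n rp NF.
rewrite subnn muln0 addn0; apply => a b c _ _ _.
by rewrite leqNgt ltn_ord.
Qed.

End ShiftedTriples.

Lemma propertyU_missing (n s q : nat) (F : {set {set 'I_n}})
    (S : seq {set 'I_n}) :
  propertyU F s q -> size S = s -> q < #|\bigcup_(A <- S) A| ->
  exists2 A, A \in S & A \notin F.
Proof.
move=> FU sS q_lt; apply/allPn; apply: contraTN q_lt => SF; rewrite -leqNgt.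
rewrite (big_nth set0) big_mkord sS; apply: FU => i.
by apply: (allP SF); rewrite mem_nth ?sS.
Qed.

(* The triples [{0, 2m+i, q-i}] pair up the points between [2m] and [q]. *)
Lemma propertyU_missing_zero_triple (n s : nat) (F : {set {set 'I_n}})
    (S : seq {set 'I_n}) :
  let q := 2 * s + 1 in let m := size S in
  propertyU F s q -> q < n -> m < s -> {subset S <= F} ->
  [set x : 'I_n | (0 < x <= 2 * m) || (x == q :> nat)]
    \subset \bigcup_(A <- S) A ->
  exists2 i, 0 < i <= s - m & triple n 0 (2 * m + i) (q - i) \notin F.
Proof.
move=> q m FU qn ms SF covS.
pose chain i := triple n 0 (2 * m + i) (q - i).
pose chains := map chain (iota 1 (s - m)).
have [||A] := @propertyU_missing _ _ _ _ (S ++ chains) FU.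
- by rewrite size_cat size_map size_iota subnKC // ltnW.
- have <- : #|ord_itv n 0 q.+1| = q.+1 by rewrite card_ord_itv subn0; lia.
  apply/subset_leq_card/subsetP => x; rewrite inE ltnS big_cat /= inE => xq.
  have [xS|xS] := boolP ((0 < x <= 2 * m) || (x == q :> nat)).
    by rewrite (subsetP covS) // inE.
  have [i i_bounds xi] : exists2 i, 0 < i <= s - m & x \in chain i.
    have [xs|xs] := leqP x (s + m); last by exists (q - x); rewrite ?inE; lia.
    by exists (maxn 1 (x - 2 * m)); rewrite ?inE; lia.
  apply/orP; right; rewrite bigcup_seq; apply/bigcupP; exists (chain i) => //.
  by rewrite map_f // mem_iota; lia.
rewrite mem_cat => /orP[/SF-> //|/mapP[i i_iota ->] NF].
by exists i => //; move: i_iota; rewrite mem_iota; lia.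
Qed.

Section ShiftedBound.

Variables (n s : nat) (F : {set {set 'I_n}}).
Hypotheses (s_ge7 : 7 <= s) (n_le3s : n <= 3 * s).
Hypotheses (F3 : F \subset ksubsets n 3) (sF : shifted F).

Let q := 2 * s + 1.
Hypothesis FU : propertyU F s q.

Lemma leq_card_shifted_nonstar : triple n 1 2 q \in F -> #|F| <= 'C(q, 3).
Proof.
move=> F12q; have qn := triple_ksubsets_lt (subsetP F3 _ F12q).
pose S := [:: triple n 1 2 q].
have [|||i /= i_bounds NFi] := @propertyU_missing_zero_triple _ _ _ S FU qn.
- by rewrite /=; lia.
- by move=> A; rewrite inE => /eqP->.
- by apply/subsetP => x; rewrite big_seq1 !inE /=; lia.
apply: leq_trans (pairs_count_leq_bin3 n_le3s (i := i) _); last lia.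
by apply: leq_card_missing_zero_triple NFi => //; lia.
Qed.

Lemma leq_card_shifted_star :
  triple n 0 1 q \in F -> triple n 1 2 q \notin F -> #|F| <= 'C(q, 3).
Proof.
move=> F01q NF12q; have qn := triple_ksubsets_lt (subsetP F3 _ F01q).
have [F234|NF234] := boolP (triple n 2 3 4 \in F); last first.
  apply: leq_trans (transversal_count_leq_bin3 s_ge7 n_le3s).
  exact: leq_card_missing_consecutive_triple NF234.
pose S := [:: triple n 0 1 q; triple n 2 3 4].
have [|||i /= i_bounds NFi] := @propertyU_missing_zero_triple _ _ _ S FU qn.
- by rewrite /=; lia.
- by move=> A; rewrite !inE => /orP[] /eqP->.
- by apply/subsetP => x; rewrite big_cons big_seq1 !inE /=; lia.
apply: leq_trans (star_count_leq_bin3 _ n_le3s (i := i) _); [|lia|lia].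
have eq_i : q - (q - i) = i by lia.
rewrite -[X in 'C(_, 2) * X]eq_i.
apply: (leq_card_missing_zero_triple_star F3 sF _ NFi); first lia.
move=> a b c abcF ab bc qc.
by have := shifted_missing_triple F3 sF abcF ab bc _ _ NF12q; lia.
Qed.

Lemma leq_card_shifted : #|F| <= 'C(q, 3).
Proof.
have [F01q|NF01q] := boolP (triple n 0 1 q \in F); last first.
  have := leq_card_missing_zero_triple F3 sF _ NF01q.
  by rewrite addn0; apply; lia.
have [F12q|NF12q] := boolP (triple n 1 2 q \in F).
  exact: leq_card_shifted_nonstar.
exact: leq_card_shifted_star.
Qed.

End ShiftedBound.

Theorem theorem7 (n s : nat) (F : {set {set 'I_n}}) :
  10 <= s -> n <= 3 * s ->
  F \subset ksubsets n 3 ->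
  propertyU F s (2 * s + 1) ->
  #|F| <= 'C(2 * s + 1, 3).
Proof.
move=> s_ge10 ns F3 FU.
have [F' [F'3 F'U sF' <-]] := shifted_reduction F3 FU.
exact: leq_card_shifted (ltnW (ltnW (ltnW s_ge10))) ns F'3 sF' F'U.
Qed.
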